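(* Let $a,b\in\mathbb{R}\setminus\{0\}$ and let $$W(x)=e^{-x^{2}}\begin{pmatrix} e^{2bx}+a^{2}x^{2} & ax\\ ax & 1\end{pmatrix},\quad x\in\mathbb{R}.$$ Then the polynomials $$Q(x,n)=\begin{pmatrix}H_n(x-b)& aH_{n+1}(x)-axH_n(x-b)\\ -anH_{n-1}(x-b)& 2e^{b^2}H_n(x)+a^2nxH_{n-1}(x-b)\end{pmatrix},\qquad n\in\mathbb{N}_0,$$ are orthogonal with respect to $W(x)$. Moreover, the leading coefficient (the coefficient of $x^n$) of $Q(x,n)$ is $$M_n=\begin{pmatrix}1&nab\\0&2e^{b^2}+a^2n\end{pmatrix}.$$
   Context: $H_n(x)=\frac{(-1)^n}{2^n}(e^{-x^2})^{(n)}e^{x^2}$ is the $n$-th monic Hermite polynomial, and terms containing $nH_{n-1}$ are zero for $n=0$. A sequence $\{Q(x,n)\}_{n\ge0}$ in $\operatorname{Mat}_2(\mathbb{C}[x])$ is a sequence of matrix-valued orthogonal polynomials with respect to $W$ if $Q(x,n)$ has degree $n$ with nonsingular leading coefficient and $\int_{\mathbb{R}}Q(x,n)W(x)Q(x,m)^*dx=0$ for $n\ne m$. *)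

(* Defs.v *)
From HB Require Import structures.
From mathcomp Require Import all_boot all_order all_algebra.
From mathcomp Require Import complex.
From mathcomp Require Import all_classical all_reals all_analysis.

Set Implicit Arguments.
Unset Strict Implicit.
Unset Printing Implicit Defensive.

Import Order.TTheory GRing.Theory Num.Theory.
Import numFieldNormedType.Exports.

Local Open Scope classical_set_scope.
Local Open Scope complex_scope.
Local Open Scope sesquilinear_scope.
Local Open Scope ring_scope.

Definition mx2 (A : Type) (p q r s : A) : 'M[A]_2 :=
  \matrix_(i, j)
    if i == ord0 then (if j == ord0 then p else q)
    else (if j == ord0 then r else s).

Definition rodrigues (R : realType) (n : nat) (x : R) : R :=
  (-1) ^+ n / 2 ^+ n * derive1n n (fun y : R => expR (- y ^+ 2)) x * expR (x ^+ 2).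

Lemma derive1n_gauss (R : realType) (n : nat) :
  exists p : {poly R}, forall x : R,
    derive1n n (fun y : R => expR (- y ^+ 2)) x = p.[x] * expR (- x ^+ 2).
Proof.
elim: n => [|n [p hp]].
  by exists 1 => x; rewrite derive1n0 hornerC mul1r.
exists (p^`() - p * ('X *+ 2)) => x.
rewrite derive1nS.
have -> : derive1n n (fun y : R => expR (- y ^+ 2))
          = (fun y => p.[y] * expR (- y ^+ 2)) by apply/funext.
have dg : is_derive x (1 : R) (fun y : R => - y ^+ 2) (- (x *+ 2)).
  apply: (is_derive_eq (is_deriveN (is_deriveX 2 (is_derive_id x (1 : R))))).
  by rewrite /GRing.scale /= expr1 mulr1 mulr_natl.
have de : is_derive x (1 : R) (fun y : R => expR (- y ^+ 2))
            (- (x *+ 2) * expR (- x ^+ 2)).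
  rewrite mulrC; exact: (@is_derive1_comp _ expR (fun y : R => - y ^+ 2)).
have dp := is_derive_poly p x.
rewrite derive1E (derive_val (is_derive := is_deriveM dp de)).
rewrite /GRing.scale /= !hornerE /=.
by rewrite -mulr2n mulrBl mulrN mulNr addrC [_ * p^`().[x]]mulrC.
Qed.

Lemma rodrigues_poly (R : realType) (n : nat) :
  exists p : {poly R}, forall x : R, p.[x] = rodrigues n x.
Proof.
have [p hp] := derive1n_gauss R n.
exists (((-1) ^+ n / 2 ^+ n)%:P * p) => x.
by rewrite /rodrigues hp !hornerE /= -!mulrA -expRD addNr expR0 mulr1.
Qed.

(* The unique polynomial whose values are given by the Rodrigues formula. *)
Definition hermite (R : realType) (n : nat) : {poly R} :=
  sval (cid (rodrigues_poly R n)).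

Lemma hermiteE (R : realType) (n : nat) (x : R) :
  (hermite R n).[x] = rodrigues n x.
Proof. by rewrite /hermite; case: cid => p /= ->. Qed.

Definition complex_integrable (R : realType) (f : R -> R[i]) : Prop :=
  (@lebesgue_measure R).-integrable setT (fun x => (complex.Re (f x))%:E) /\
  (@lebesgue_measure R).-integrable setT (fun x => (complex.Im (f x))%:E).

Definition complex_integral (R : realType) (f : R -> R[i]) : R[i] :=
  Rintegral (@lebesgue_measure R) setT (fun x => complex.Re (f x)) +i*
  Rintegral (@lebesgue_measure R) setT (fun x => complex.Im (f x)).

Definition mx_integrable (R : realType) (N : nat) (F : R -> 'M[R[i]]_N) : Prop :=
  forall i j, complex_integrable (fun x => F x i j).

Definition mx_integral (R : realType) (N : nat) (F : R -> 'M[R[i]]_N) :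
    'M[R[i]]_N :=
  \matrix_(i, j) complex_integral (fun x => F x i j).

Definition mxpoly_eval (R : realType) (N : nat) (P : 'M[{poly R[i]}]_N) (x : R) :
    'M[R[i]]_N :=
  map_mx (fun p : {poly R[i]} => p.[x%:C]) P.

Definition mxpoly_coef (R : realType) (N : nat) (P : 'M[{poly R[i]}]_N) (k : nat) :
    'M[R[i]]_N :=
  map_mx (fun p : {poly R[i]} => p`_k) P.

Definition mxpoly_pairing (R : realType) (N : nat) (W : R -> 'M[R[i]]_N)
    (P Q : 'M[{poly R[i]}]_N) (x : R) : 'M[R[i]]_N :=
  mxpoly_eval P x *m W x *m (mxpoly_eval Q x)^t*.

(* Integrability is explicit because the integral of a non-integrable function
   is a default value. *)
Definition is_MVOP (R : realType) (N : nat) (W : R -> 'M[R[i]]_N)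
    (Q : nat -> 'M[{poly R[i]}]_N) : Prop :=
  (forall n : nat,
     (forall i j, (size (Q n i j) <= n.+1)%N) /\
     mxpoly_coef (Q n) n \in unitmx) /\
  (forall n m : nat, n <> m ->
     mx_integrable (mxpoly_pairing W (Q n) (Q m)) /\
     mx_integral (mxpoly_pairing W (Q n) (Q m)) = 0).

Definition weightW (R : realType) (a b x : R) : 'M[R[i]]_2 :=
  map_mx (real_complex R)
    (expR (- x ^+ 2) *:
     mx2 (expR (2 * b * x) + a ^+ 2 * x ^+ 2) (a * x)
         (a * x)                              1).

(* Since n.-1 = 0 for n = 0, the factor n%:R makes the terms containing
   n H_(n-1) vanish there. *)
Definition polyQ (R : realType) (a b : R) (n : nat) : 'M[{poly R[i]}]_2 :=
  let H := hermite R in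
  let Hb k := H k \Po ('X - b%:P) in
  map_mx (map_poly (real_complex R))
    (mx2 (Hb n)
         (a *: H n.+1 - a *: ('X * Hb n))
         (- (a * n%:R) *: Hb n.-1)
         ((2 * expR (b ^+ 2)) *: H n + (a ^+ 2 * n%:R) *: ('X * Hb n.-1))).

Definition leadM (R : realType) (a b : R) (n : nat) : 'M[R[i]]_2 :=
  map_mx (real_complex R)
    (mx2 1 (n%:R * a * b)
         0 (2 * expR (b ^+ 2) + a ^+ 2 * n%:R)).

(* Main.v *)
Require Import Defs.
From mathcomp Require Import all_boot all_order all_algebra.
From mathcomp Require Import complex ring lra.
From mathcomp Require Import all_classical all_reals all_analysis.
From mathcomp Require Import measurable_realfun.

Import Order.TTheory GRing.Theory Num.Theory.
Import numFieldNormedType.Exports.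

Local Open Scope classical_set_scope.
Local Open Scope complex_scope.
Local Open Scope sesquilinear_scope.
Local Open Scope ring_scope.

(* With T(x) = [[1, a x], [0, 1]] one has
   W(x) = T(x) diag(e^(b^2) e^(-(x-b)^2), e^(-x^2)) T(x)^*, and
   Q(x,n) T(x) = [[H_n(x-b), a H_(n+1)(x)], [-a n H_(n-1)(x-b), 2 e^(b^2) H_n(x)]].
   Each entry of the pairing integral is thus a sum of two scalar Hermite pairings,
   one translated by b.  The scalar orthogonality and norms n! sqrt(pi) / 2^n come
   from the fact that the integral of (q' - 2 X q) e^(-x^2) vanishes; off the
   diagonal of the matrix, the two norms that occur cancel since
   h_(n+1) = (n+1)/2 h_n. *)

(** * Hermite polynomials: recurrence, derivative and degree *)

Section hermite.
Context {R : realType}.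
Implicit Types (p q : {poly R}) (m x : R) (n k : nat).

Definition shifted_gauss m x : R := expR (- (x - m) ^+ 2).

Definition gauss_deriv p : {poly R} := p^`() - p * ('X *+ 2).

Lemma is_derive_poly_gauss m p x :
  is_derive x (1 : R) (fun y => p.[y - m] * shifted_gauss m y)
    ((gauss_deriv p).[x - m] * shifted_gauss m x).
Proof.
have ds : is_derive x (1 : R) (fun y : R => y - m) 1.
  by apply: is_derive_eq; rewrite subr0.
have dg : is_derive x (1 : R) (fun y : R => - (y - m) ^+ 2) (- ((x - m) *+ 2)).
  apply: is_derive_eq.
  by rewrite /GRing.scale /= mulr1.
have de : is_derive x (1 : R) (shifted_gauss m)
            (- ((x - m) *+ 2) * shifted_gauss m x).
  by rewrite mulrC; exact: (@is_derive1_comp _ expR (fun y : R => - (y - m) ^+ 2)).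
have dp : is_derive x (1 : R) (fun y : R => p.[y - m]) p^`().[x - m].
  rewrite -[X in is_derive _ _ _ X]mulr1.
  have dp := is_derive_poly p (x - m).
  exact: (@is_derive1_comp _ (horner p) (fun y : R => y - m)).
apply: is_derive_eq.
by rewrite /GRing.scale /= /gauss_deriv !hornerE /=; ring.
Qed.

Lemma hermite_gauss n x :
  (hermite R n).[x] * shifted_gauss 0 x
  = (-1) ^+ n / 2 ^+ n * derive1n n (shifted_gauss 0) x.
Proof.
have -> : shifted_gauss 0 = (fun y : R => expR (- y ^+ 2)).
  by apply/funext => y; rewrite /shifted_gauss subr0.
by rewrite hermiteE /rodrigues -!mulrA -expRD subrr expR0 mulr1.
Qed.

Lemma poly_eq_horner p q : (forall x, p.[x] = q.[x]) -> p = q.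
Proof.
move=> pq; apply/eqP; rewrite -subr_eq0; apply/eqP.
(* The difference vanishes at [size (p - q)] distinct naturals, more points than its degree
   allows. *)
apply: (@roots_geq_poly_eq0 _ _ [seq i%:R | i <- iota 0 (size (p - q))]).
- by apply/allP => _ /mapP[i _ ->]; rewrite /root !hornerE pq subrr.
- rewrite map_inj_uniq ?iota_uniq// => i j /eqP; rewrite eqr_nat => /eqP//.
- by rewrite size_map size_iota.
Qed.

Lemma hermite0 : hermite R 0 = 1.
Proof.
apply: poly_eq_horner => x.
by rewrite hermiteE /rodrigues derive1n0 !expr0 divr1 mul1r -expRD addNr expR0 hornerC.
Qed.

(** The Rodrigues formula says that the [n]-th derivative of [e^(-x^2)] is [(-2)^n H_n(x) e^(-x^2)];
    differentiating once more turns the polynomial factor into its [gauss_deriv]. *)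
Lemma hermiteS n :
  hermite R n.+1 = 'X * hermite R n - 2^-1 *: (hermite R n)^`().
Proof.
apply: poly_eq_horner => x.
have g0 : shifted_gauss 0 x != 0 by rewrite gt_eqF ?expR_gt0.
apply: (mulIf g0); rewrite hermite_gauss derive1nS.
have -> : derive1n n (shifted_gauss 0) =
    (fun y => ((- 2) ^+ n *: hermite R n).[y - 0] * shifted_gauss 0 y).
  apply/funext => y; rewrite subr0 hornerZ -mulrA hermite_gauss mulrA.
  rewrite [X in X * _](_ : _ = 1) ?mul1r//.
  by rewrite mulrA -exprMn mulrNN mulr1 divff ?expf_neq0.
have d := is_derive_poly_gauss 0 ((- 2) ^+ n *: hermite R n) x.
rewrite derive1E (derive_val (is_derive := d)) subr0 mulrA; congr (_ * _).
rewrite /gauss_deriv derivZ -scalerAl !(hornerZ, hornerD, hornerN, hornerM, hornerMn, hornerX).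
rewrite exprS [2 ^+ n.+1]exprS [(-2)^+n]exprNn.
have s1 : (-1) ^+ n * (-1) ^+ n = 1 :> R by rewrite -exprMn mulrNN mulr1 expr1n.
have : 2 ^+ n != 0 :> R by rewrite expf_neq0.
move: ((-1) ^+ n : R) s1 (2 ^+ n : R) => s s1 t t0.
transitivity (- (s * s) / 2 * ((hermite R n)^`().[x] - (hermite R n).[x] * (x *+ 2))).
  by rewrite /GRing.scale /=; field.
by rewrite s1; field.
Qed.

(** Differentiating [hermiteS] and inserting the induction hypothesis leaves
    [H_(n+1) + (n+1) (X H_n - H_n'/2)], whose bracket is [H_(n+1)] again. *)
Lemma derivS_hermite n : (hermite R n.+1)^`() = n.+1%:R *: hermite R n.
Proof.
elim: n => [|n IHn].
  by rewrite hermiteS hermite0 mulr1 derivB derivX derivZ -polyC1 !derivC scaler0 subr0 scale1r.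
rewrite hermiteS derivB derivM derivX derivZ IHn derivZ mul1r.
by rewrite -[n.+2]addn1 natrD scalerDl scale1r hermiteS -!mul_polyC; ring.
Qed.

Lemma deriv_hermite n : (hermite R n)^`() = n%:R *: hermite R n.-1.
Proof.
by case: n => [|n]; rewrite ?derivS_hermite// hermite0 -polyC1 derivC scale0r.
Qed.

Lemma size_hermite n : size (hermite R n) = n.+1.
Proof.
elim: n => [|n IHn]; first by rewrite hermite0 size_poly1.
have h0 : hermite R n != 0 by rewrite -size_poly_eq0 IHn.
have sX : size ('X * hermite R n) = n.+2 by rewrite mulrC size_mulX// IHn.
rewrite hermiteS size_polyDl ?sX// size_polyN.
rewrite (leq_ltn_trans (size_scale_leq _ _))//.
by rewrite (ltn_trans (lt_size_deriv h0))// IHn.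
Qed.
End hermite.

(** * Gaussian integrals of polynomials and scalar orthogonality *)

Section gaussian.
Context {R : realType}.
Implicit Types (p q : {poly R}) (m x : R) (n k : nat).
Local Notation mu := (@lebesgue_measure R).

(** The rate [e] is arbitrary so that the induction can spend half of it on the shorter polynomial
    and the other half on the extra factor [x]. *)
Lemma poly_le_expR_sqr p (e : R) : 0 < e ->
  exists2 C, 0 <= C & forall x, `|p.[x]| <= C * expR (e * x ^+ 2).
Proof.
elim/poly_ind: p e => [|p c IH] e e0.
  by exists 0 => // x; rewrite horner0 normr0 mul0r.
have [C C0 HC] := IH (e / 2) ltac:(by rewrite divr_gt0).
have K0 : 0 <= 1 + 2 / e by rewrite addr_ge0// divr_ge0// ltW.
exists (C * (1 + 2 / e) + `|c|); first by rewrite addr_ge0// mulr_ge0.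
move=> x; rewrite hornerMXaddC (le_trans (ler_normD _ _))// normrM.
have -> : expR (e * x ^+ 2) = expR (e / 2 * x ^+ 2) ^+ 2.
  by rewrite [RHS]expr2 -expRD; congr expR; field.
have := expR_ge1Dx (e / 2 * x ^+ 2); have := HC x.
move: (expR _) => E pE eE.
have sq0 : 0 <= x ^+ 2 by rewrite sqr_ge0.
have E1 : 1 <= E by rewrite (le_trans _ eE)// lerDl mulr_ge0// divr_ge0// ltW.
have E0 : 0 <= E by exact: le_trans E1.
have EE : E <= E ^+ 2 by rewrite expr2 ler_peMl.
have xE : `|x| <= (1 + 2 / e) * E.
  (* This follows from [(|x| - 1/2)^2 >= 0]; then [1 <= E] and [e/2 * x^2 <= E] give the constant
     [1 + 2/e]. *)
  have x1 : `|x| <= 1 + x ^+ 2.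
    rewrite -real_normK ?num_real//; have := sqr_ge0 (`|x| - 2^-1).
    by rewrite sqrrB; lra.
  apply: (le_trans x1).
  have -> : x ^+ 2 = 2 / e * (e / 2 * x ^+ 2) by field; rewrite gt_eqF.
  rewrite [leRHS]mulrDl mul1r lerD// ler_wpM2l ?divr_ge0 ?(ltW e0)//.
  by rewrite (le_trans _ eE)// lerDr.
rewrite [leRHS]mulrDl lerD//; last by rewrite ler_peMr ?(le_trans E1).
have -> : C * (1 + 2 / e) * E ^+ 2 = (C * E) * ((1 + 2 / e) * E) by ring.
by rewrite ler_pM.
Qed.

Lemma continuous_poly_gauss m p :
  continuous (fun x : R => p.[x - m] * shifted_gauss m x).
Proof.
move=> x; apply/differentiable_continuous/derivable1_diffP.
exact: (@ex_derive _ _ _ _ _ _ _ (is_derive_poly_gauss m p x)).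
Qed.

(** Bounding [p] at rate 1/2 leaves [e^(-(x-m)^2/2)], a multiple of the normal density of mean [m]
    and variance 1, which dominates. *)
Lemma integrable_poly_gauss m p :
  mu.-integrable setT (EFin \o (fun x => p.[x - m] * shifted_gauss m x)).
Proof.
have [C C0 HC] := poly_le_expR_sqr p 2^-1 ltac:(by rewrite invr_gt0).
have pk : 0 < normal_peak (1 : R) by exact: normal_peak_gt0 (oner_neq0 _).
have := @integrableZl _ _ R mu _ measurableT (C / normal_peak 1) _ (integrable_normal_pdf m 1).
apply: le_integrable => //.
  apply/measurable_EFinP; apply: continuous_measurable_fun.
  exact: continuous_poly_gauss.
move=> x _; rewrite /= lee_fin normrM [leRHS]ger0_norm; last first.
  by rewrite mulr_ge0 ?normal_pdf_ge0// divr_ge0// ltW.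
rewrite normal_pdfE ?oner_neq0// mulrA divfK ?gt_eqF//.
rewrite [`|shifted_gauss _ _|]ger0_norm ?expR_ge0//.
apply: le_trans (ler_wpM2r (expR_ge0 _) (HC _)) _.
rewrite -mulrA -expRD ler_wpM2l// ler_expR expr1n.
by rewrite le_eqVlt; apply/orP; left; apply/eqP; field.
Qed.

(* The factor [x] is absorbed by replacing [p] with [p * ('X + m)]. *)
Lemma poly_gauss_decay m p :
  exists C, forall x, `|x| * `|p.[x - m] * shifted_gauss m x| <= C.
Proof.
have [C C0 HC] := poly_le_expR_sqr (p * ('X + m%:P)) 1 ltr01.
exists C => x; rewrite -normrM mulrCA mulrA normrM.
have -> : p.[x - m] * x = (p * ('X + m%:P)).[x - m].
  by rewrite hornerM hornerD hornerX hornerC subrK.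
rewrite [`|shifted_gauss _ _|]ger0_norm ?expR_ge0//.
apply: le_trans (ler_wpM2r (expR_ge0 _) (HC _)) _.
by rewrite -mulrA -expRD mul1r subrr expR0 mulr1.
Qed.

(** Taking [s] to be 1 or -1 gives the boundary terms at both ends of the growing intervals. *)
Lemma cvg_poly_gauss m p (s : R) : `|s| = 1 ->
  (fun x => p.[x - m] * shifted_gauss m x) (s * k.+1%:R) @[k --> \oo] --> (0 : R).
Proof.
move=> s1; have [C HC] := poly_gauss_decay m p.
apply/norm_cvg0P.
apply: (@squeeze_cvgr _ _ _ _ (cst 0) (fun k => C * k.+1%:R^-1)).
- apply: nearW => k; rewrite normr_ge0/= -ler_pdivrMr ?invr_gt0// invrK mulrC.
  by have := HC (s * k.+1%:R); rewrite normrM s1 mul1r normr_nat.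
- exact: cvg_cst.
- by rewrite -[X in _ --> X](mulr0 C); apply: cvgM (cvg_cst _) cvg_harmonic.
Qed.

Definition gauss_int m p : R :=
  Rintegral mu setT (fun x => p.[x - m] * shifted_gauss m x).

(** The integrand is the derivative of [F], so its integral over [[-(k+1), k+1]] is a difference of
    boundary values tending to 0; dominated convergence identifies the limit with the full
    integral. *)
Lemma gauss_int_deriv m p : gauss_int m (gauss_deriv p) = 0.
Proof.
pose F x := p.[x - m] * shifted_gauss m x.
pose f x := (gauss_deriv p).[x - m] * shifted_gauss m x.
pose I (k : nat) : set R := `[- k.+1%:R, k.+1%:R]%classic.
pose fk (k : nat) : R -> \bar R := (EFin \o f) \_ (I k).
have intf : mu.-integrable setT (EFin \o f) by exact: integrable_poly_gauss.
have cf : continuous f by exact: continuous_poly_gauss.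
have [] := @dominated_convergence _ _ _ mu setT measurableT fk (EFin \o f) (abse \o (EFin \o f)).
- move=> k; have mI : measurable (I k) by exact: measurable_itv.
  apply/(measurable_restrictT _ mI); apply: measurable_funTS.
  exact: measurable_int intf.
- exact: measurable_int intf.
- apply: aeW => x _; apply: cvg_near_cst; near=> k.
  rewrite /fk patchE ifT// inE /I/= in_itv/= -ler_norml.
  rewrite (@le_trans _ _ k%:R) ?ler_nat//.
  by near: k; exact: nbhs_infty_ger.
- exact: integrable_abse.
- apply: aeW => x k _; rewrite /fk patchE; case: ifPn => //= _.
  by rewrite normr0 lee_fin.
move=> _ _ lim1.
(* The endpoints use [k+1] so that the interval is nondegenerate already at [k = 0]. *)
have FTC k : (\int[mu]_x fk k x = (F k.+1%:R - F (- k.+1%:R))%:E)%E.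
  rewrite -integral_mkcond (@continuous_FTC2 _ f F).
  - by [].
  - by rewrite gtrN.
  - exact: continuous_subspaceT.
  - split.
    + by move=> x _; exact: (@ex_derive _ _ _ _ _ _ _ (is_derive_poly_gauss m p x)).
    + by apply: cvg_at_right_filter; exact: continuous_poly_gauss.
    + by apply: cvg_at_left_filter; exact: continuous_poly_gauss.
  - move=> x _; rewrite derive1E.
    exact: (derive_val (is_derive := is_derive_poly_gauss m p x)).
have lim2 : (\int[mu]_x fk k x)%E @[k --> \oo] --> 0%E.
  under eq_fun do rewrite FTC.
  apply: cvg_EFin; first exact: nearW.
  rewrite -[X in _ --> X](subr0 (0 : R)); apply: cvgB.
    have := cvg_poly_gauss m p 1 (normr1 R).
    by under eq_fun do rewrite mul1r.
  have := cvg_poly_gauss m p (-1) ltac:(by rewrite normrN1).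
  by under eq_fun do rewrite mulN1r.
by rewrite /gauss_int /Rintegral (cvg_unique _ lim1 lim2).
Unshelve. all: by end_near.
Qed.

Lemma gauss_intD m p q : gauss_int m (p + q) = gauss_int m p + gauss_int m q.
Proof.
rewrite -RintegralD//; [|exact: integrable_poly_gauss..].
by apply: eq_Rintegral => x _; rewrite hornerD mulrDl.
Qed.

Lemma gauss_intZ m c p : gauss_int m (c *: p) = c * gauss_int m p.
Proof.
rewrite -RintegralZl//; last exact: integrable_poly_gauss.
by apply: eq_Rintegral => x _; rewrite hornerZ mulrA.
Qed.

Lemma gauss_int1 m : gauss_int m 1 = Num.sqrt pi.
Proof.
(* With variance 1/2 the normal density is exactly [e^(-(x-m)^2) / sqrt(pi)]. *)
pose s : R := (Num.sqrt 2)^-1.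
have s2 : s ^+ 2 *+ 2 = 1.
  by rewrite exprVn sqr_sqrtr// -mulr_natr mulVf.
have s0 : s != 0 by rewrite invr_neq0// gt_eqF// sqrtr_gt0.
have pi0 : Num.sqrt (pi : R) != 0 by rewrite gt_eqF// sqrtr_gt0 pi_gt0.
have pk : normal_peak s = (Num.sqrt pi)^-1.
  by rewrite /normal_peak -mulrnAl s2 mul1r.
apply: (mulfI (invr_neq0 pi0)); rewrite mulVf// -RintegralZl//; last first.
  exact: integrable_poly_gauss.
rewrite -[RHS]/(fine 1%:E) -(integral_normal_pdf m s); congr fine.
apply: eq_integral => x _; rewrite normal_pdfE// pk hornerC mul1r.
by rewrite /normal_fun s2 divr1.
Qed.

(** Integration by parts: by [hermiteS], [gauss_deriv (q H_n)] equals [q' H_n - 2 q H_(n+1)], and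
    its integral vanishes. *)
Lemma gauss_int_hermiteS m q n :
  gauss_int m (q * hermite R n.+1) = 2^-1 * gauss_int m (q^`() * hermite R n).
Proof.
have := gauss_int_deriv m (q * hermite R n).
have -> : gauss_deriv (q * hermite R n) =
    q^`() * hermite R n + (- 2) *: (q * hermite R n.+1).
  have e : q * (hermite R n)^`() = 2 * ((2^-1)%:P * (q * (hermite R n)^`())).
    by rewrite mulrA -[2]polyC_natr -polyCM mulfV// mul1r.
  rewrite /gauss_deriv derivM hermiteS scaleNr -!mul_polyC polyC_natr e.
  ring.
rewrite gauss_intD gauss_intZ => H; apply: (@mulfI _ 2) => //; lra.
Qed.

(** Each integration by parts lowers both indices by one and yields a factor [(n+1)/2], until one
    index is 0. *)
Lemma gauss_int_hermite m n k : gauss_int m (hermite R n * hermite R k) =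
  if n == k then n`!%:R / 2 ^+ n * Num.sqrt pi else 0.
Proof.
have z j : gauss_int m (1 * hermite R j.+1) = 0.
  rewrite gauss_int_hermiteS -polyC1 derivC mul0r.
  by rewrite -(scale0r 0) gauss_intZ mul0r mulr0.
elim: n k => [|n IHn] [|k].
- by rewrite hermite0 mulr1 gauss_int1 fact0 expr0 divr1 mul1r.
- by rewrite hermite0 z.
- by rewrite mulrC hermite0 z.
- rewrite gauss_int_hermiteS derivS_hermite -scalerAl gauss_intZ IHn eqSS.
  case: eqP => _; last by rewrite !mulr0.
  by rewrite factS natrM exprS; field; rewrite expf_neq0.
Qed.
End gaussian.

(** * Degrees and top coefficients of translated Hermite polynomials *)

Section degrees.
Context {R : realType}.
Implicit Types (b : R) (n k : nat).

Definition shifted_hermite b n : {poly R} := hermite R n \Po ('X - b%:P).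

(** Lets the coefficient lemmas below serve the untranslated polynomials too. *)
Lemma shifted_hermite0r n : shifted_hermite 0 n = hermite R n.
Proof. by rewrite /shifted_hermite subr0 comp_polyXr. Qed.

Lemma shifted_hermiteS b n : shifted_hermite b n.+1 =
  'X * shifted_hermite b n - b *: shifted_hermite b n
    - (2^-1 * n%:R) *: shifted_hermite b n.-1.
Proof.
rewrite /shifted_hermite hermiteS deriv_hermite comp_polyB comp_polyM comp_polyX.
by rewrite !comp_polyZ scalerA mulrBl mul_polyC.
Qed.

Lemma size_shifted_hermite b n : size (shifted_hermite b n) = n.+1.
Proof. by rewrite size_comp_poly2 ?size_XsubC// size_hermite. Qed.

Lemma coef_shifted_hermite_ge b n k : (n < k)%N -> (shifted_hermite b n)`_k = 0.
Proof. by move=> nk; rewrite nth_default// size_shifted_hermite. Qed.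

Lemma coef_shifted_hermite b n : (shifted_hermite b n)`_n = 1.
Proof.
elim: n => [|n IHn]; first by rewrite /shifted_hermite hermite0 -polyC1 comp_polyC coefC.
rewrite shifted_hermiteS !coefB coefXM !coefZ /= IHn.
rewrite !coef_shifted_hermite_ge ?mulr0 ?subr0//.
by rewrite ltnS leq_pred.
Qed.

(** The second coefficient is needed because the [x^(n+1)] terms cancel in the upper right entry of
    [Q(x,n)]; it is the source of [nab] in the leading matrix. *)
Lemma coef_pred_shifted_hermite b n : (shifted_hermite b n.+1)`_n = - (n.+1%:R * b).
Proof.
elim: n => [|n IHn]; rewrite shifted_hermiteS !coefB coefXM !coefZ /= coef_shifted_hermite.
  by rewrite mulr0 mul0r subr0 sub0r mulr1 mul1r.
rewrite IHn coef_shifted_hermite_ge// mulr0 subr0 mulr1.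
by rewrite [n.+2%:R]mulrSr mulrDl mul1r opprD.
Qed.
End degrees.

(** * Matrix orthogonality and leading coefficients *)

Section matrices.
Context {R : realType} (a b : R).
Implicit Types (n m : nat) (i j : 'I_2).

(* The two columns of [Q(x,n) T(x)]; [leftQ] is to be evaluated at [x - b]. *)
Definition leftQ n i : {poly R} :=
  if i == ord0 then hermite R n else - (a * n%:R) *: hermite R n.-1.

Definition rightQ n i : {poly R} :=
  if i == ord0 then a *: hermite R n.+1 else (2 * expR (b ^+ 2)) *: hermite R n.

Lemma mxpoly_eval_real N (P : 'M[{poly R}]_N) x :
  mxpoly_eval (map_mx (map_poly (real_complex R)) P) x
  = map_mx (real_complex R) (map_mx (fun p => p.[x]) P).
Proof. by apply/matrixP => i j; rewrite !mxE horner_map. Qed.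

Lemma adjoint_real_mx N (A : 'M[R]_N) :
  (map_mx (real_complex R) A)^t* = map_mx (real_complex R) A^T.
Proof.
apply/matrixP => i j; rewrite !mxE.
exact: conjc_real.
Qed.

(** The entry of [(Q_n T) D (Q_m T)^*], with [D] the diagonal factor of the weight; [x - 0] keeps
    both summands in the shape integrated by [gauss_int]. *)
Definition pairing_density n m i j (x : R) : R :=
  expR (b ^+ 2) * ((leftQ n i * leftQ m j).[x - b] * shifted_gauss b x)
    + (rightQ n i * rightQ m j).[x - 0] * shifted_gauss 0 x.

Lemma mxpoly_pairing_polyQ n m x i j :
  mxpoly_pairing (weightW a b) (polyQ a b n) (polyQ a b m) x i j
  = (pairing_density n m i j x)%:C.
Proof.
rewrite /mxpoly_pairing /weightW /polyQ !mxpoly_eval_real adjoint_real_mx.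
rewrite -!map_mxM mxE; congr (_ %:C).
(* Completing the square: [2bx - x^2 = b^2 - (x-b)^2]. *)
have eW : expR (2 * b * x) * expR (- x ^+ 2) = expR (b ^+ 2) * shifted_gauss b x.
  by rewrite -!expRD; congr expR; ring.
have e0 : shifted_gauss 0 x = expR (- x ^+ 2) by rewrite /shifted_gauss subr0.
rewrite !mxE !big_ord_recl !big_ord0 !mxE !big_ord_recl !big_ord0 !mxE.
rewrite /pairing_density [in RHS]mulrCA -eW e0 subr0 /leftQ /rightQ.
case: i => [[|[|//]] /= ?]; case: j => [[|[|//]] /= ?];
  rewrite /eq_op /= !(hornerD, hornerN, hornerZ, hornerM, hornerX, horner_comp, hornerC);
  ring.
Qed.

Lemma integrable_pairing_density n m i j :
  (@lebesgue_measure R).-integrable setT (EFin \o pairing_density n m i j).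
Proof.
exact: (integrableD measurableT
  (integrableZl measurableT _ (integrable_poly_gauss b _)) (integrable_poly_gauss 0 _)).
Qed.

Lemma Rintegral_pairing_density n m i j :
  Rintegral (@lebesgue_measure R) setT (pairing_density n m i j) =
  expR (b ^+ 2) * gauss_int b (leftQ n i * leftQ m j)
    + gauss_int 0 (rightQ n i * rightQ m j).
Proof.
rewrite RintegralD//; last 2 first.
- exact: (integrableZl measurableT _ (integrable_poly_gauss b _)).
- exact: integrable_poly_gauss.
by rewrite RintegralZl//; exact: integrable_poly_gauss.
Qed.

Lemma Rintegral_pairing_density_eq0 n m i j : n <> m ->
  Rintegral (@lebesgue_measure R) setT (pairing_density n m i j) = 0.
Proof.
move=> nm; rewrite Rintegral_pairing_density /leftQ /rightQ.
have cross k l : expR (b ^+ 2) * gauss_int b (hermite R k * (- (a * l%:R) *: hermite R l.-1))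
    + gauss_int 0 (a *: hermite R k.+1 * ((2 * expR (b ^+ 2)) *: hermite R l)) = 0.
  rewrite -!(scalerAl, scalerAr) !gauss_intZ !gauss_int_hermite.
  (* At [l = 0] the first term dies by its factor [l] and the second by orthogonality of [H_(k+1)]
     and [H_0]. Otherwise both norms are nonzero exactly when [l = k+1] in the original index. *)
  case: l => [|l]; first by rewrite mulr0 oppr0 !(mul0r, mulr0) addr0.
  rewrite eqSS /=; case: eqP => [->|_]; last by rewrite !mulr0 addr0.
  by rewrite factS natrM [2 ^+ _.+1]exprS; field; rewrite expf_neq0.
case: i => [[|[|//]] /= ?]; case: j => [[|[|//]] /= ?]; rewrite /eq_op /=.
- rewrite -!(scalerAl, scalerAr) !gauss_intZ !gauss_int_hermite eqSS.
  by case: eqP => // _; rewrite !mulr0 addr0.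
- exact: cross.
- by rewrite [X in gauss_int b X]mulrC [X in gauss_int 0 X]mulrC cross.
- rewrite -!(scalerAl, scalerAr) !gauss_intZ !gauss_int_hermite.
  case: (n =P m) => // _; rewrite !mulr0 addr0.
  (* The indices 0 and 1 share the predecessor 0, so there the term vanishes through the factor [n]
     or [m], not through orthogonality. *)
  case: n m nm => [|n] [|m] nm //=; rewrite ?mulr0 ?oppr0 ?(mul0r, mulr0)//.
  by case: eqP => [nm'|_]; [case: nm; rewrite nm'|rewrite !mulr0].
Qed.

Lemma orthogonal_polyQ n m : n <> m ->
  mx_integrable (mxpoly_pairing (weightW a b) (polyQ a b n) (polyQ a b m)) /\
  mx_integral (mxpoly_pairing (weightW a b) (polyQ a b n) (polyQ a b m)) = 0.
Proof.
move=> nm.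
have E i j : (fun x => mxpoly_pairing (weightW a b) (polyQ a b n) (polyQ a b m) x i j)
    = (fun x => (pairing_density n m i j x)%:C).
  by apply/funext => x; exact: mxpoly_pairing_polyQ.
split=> [i j|].
  rewrite E; split; first exact: integrable_pairing_density.
  exact: integrable0.
apply/matrixP => i j; rewrite !mxE E /complex_integral /=.
rewrite Rintegral_pairing_density_eq0//.
rewrite [X in _ +i* X](_ : _ = 0) //.
by rewrite /Rintegral integral0.
Qed.

Lemma size_polyQ n i j : (size (polyQ a b n i j) <= n.+1)%N.
Proof.
rewrite mxE size_map_poly mxE -/(shifted_hermite b n) -/(shifted_hermite b n.-1).
have nn : (n.-1 <= n)%N by exact: leq_pred.
have sZ (c : R) (p : {poly R}) k : (size p <= k)%N -> (size (c *: p) <= k)%N.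
  by move=> pk; exact: leq_trans (size_scale_leq _ _) pk.
case: ifP => _; case: ifP => _.
- by rewrite size_shifted_hermite.
(* Each of the two terms has degree [n+1] when [a] is nonzero; as the Hermite polynomials are monic,
   their top coefficients cancel. *)
- apply/leq_sizeP => k nk; rewrite coefB !coefZ coefXM.
  case: k nk => // k; rewrite ltnS /= leq_eqVlt => /predU1P[<-|nk].
    by rewrite -shifted_hermite0r !coef_shifted_hermite subrr.
  by rewrite -shifted_hermite0r !coef_shifted_hermite_ge// mulr0 subrr.
- by rewrite sZ// size_shifted_hermite.
- apply: leq_trans (size_polyD _ _) _; rewrite geq_max sZ ?size_hermite//=.
  (* At [n = 0] the product [X H_(n.-1)] has degree 1, too large, but its scalar is 0. *)
  case: n nn => [|n] nn; first by rewrite mulr0 scale0r size_poly0.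
  by rewrite sZ// mulrC size_mulX -?size_poly_eq0 size_shifted_hermite.
Qed.

Lemma coef_polyQ n : mxpoly_coef (polyQ a b n) n = leadM a b n.
Proof.
apply/matrixP => i j; rewrite !mxE coef_map; congr (_ %:C).
rewrite -/(shifted_hermite b n) -/(shifted_hermite b n.-1).
case: ifP => _; case: ifP => _.
- exact: coef_shifted_hermite.
- rewrite coefB !coefZ coefXM -shifted_hermite0r coef_pred_shifted_hermite.
  case: n => [|n]; first by rewrite /=; ring.
  by rewrite /= coef_pred_shifted_hermite; ring.
- rewrite coefZ; case: n => [|n]; first by rewrite mulr0 oppr0 mul0r.
  by rewrite coef_shifted_hermite_ge ?mulr0.
- rewrite coefD !coefZ coefXM -shifted_hermite0r coef_shifted_hermite mulr1.
  case: n => [|n]; first by rewrite !mulr0.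
  by rewrite /= coef_shifted_hermite mulr1.
Qed.

Lemma unitmx_leadM n : leadM a b n \in unitmx.
Proof.
(* The matrix is upper triangular, so it is transposed to fit [det_trig]; its determinant
   [2 e^(b^2) + a^2 n] is positive. *)
rewrite map_unitmx unitmxE -det_tr det_trig; last first.
  apply/is_trig_mxP => -[[|[|//]] ?] -[[|[|//]] ?] // _.
  by rewrite !mxE.
rewrite !big_ord_recl big_ord0 !mxE /= unitfE mul1r mulr1.
by rewrite gt_eqF// ltr_wpDr ?mulr_gt0 ?expR_gt0// mulr_ge0 ?sqr_ge0.
Qed.
End matrices.

Theorem proposition5p1 (R : realType) (a b : R) (a_neq0 : a != 0) (b_neq0 : b != 0) :
  is_MVOP (weightW a b) (polyQ a b) /\
  (forall n : nat, mxpoly_coef (polyQ a b n) n = leadM a b n).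
Proof.
split; last exact: coef_polyQ.
split=> [n|n m]; last exact: orthogonal_polyQ.
by split; [exact: size_polyQ|rewrite coef_polyQ unitmx_leadM].
Qed.
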